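(* For $p>0$ let $\Psi_p(t):=\min\{t/p,1\}$, $t\in[0,1]$. In the weak-* topology of $L^\infty(\mathcal{X};\nu)$, the functionals $\mathrm{ProbR}_{\Psi_p}$ $\Gamma$-converge, as $p\to1$, to the functional $$A\mapsto\mathbb{E}_{(x,y)\sim\mu}\big[|\mathbf{1}_A(x)-y|\big]+\int_A\int_{A^c}d\mathfrak{m}_x(\tilde x)\,d\rho_1(x)+\int_{A^c}\int_{A}d\mathfrak{m}_x(\tilde x)\,d\rho_0(x),$$ and, as $p\to\infty$, to the functional $A\mapsto\mathbb{E}_{(x,y)\sim\mu}\big[|\mathbf{1}_A(x)-y|\big]$.
   Context: Setting: $\mathcal{X}$ is a set, $\mathcal{A}\subset 2^{\mathcal{X}}$ a $\sigma$-algebra, and $\mu$ a probability measure on $(\mathcal{X}\times\{0,1\},\mathcal{A}\otimes 2^{\{0,1\}})$. For $i\in\{0,1\}$ put $\rho_i(B):=\mu(B\times\{i\})$, and $\rho:=\rho_0+\rho_1$. $\{\mathfrak{m}_x\}_{x\in\mathcal{X}}$ is a family such that $\mathfrak{m}_x$ is a probability measure on $(\mathcal{X},\mathcal{A})$ for $\rho$-almost every $x$, and $x\mapsto\mathfrak{m}_x(B)$ is measurable for every $B\in\mathcal{A}$. Define $\nu(B):=\frac12\int_{\mathcal{X}}\mathfrak{m}_x(B)\,d\rho(x)+\frac12\rho(B)$. For $A\in\mathcal{A}$: $$\mathrm{ProbR}_\Psi(A):=\rho_0(A)+\rho_1(A^c)+\int_{A^c}\Psi(\mathfrak{m}_x(A))\,d\rho_0(x)+\int_{A}\Psi(\mathfrak{m}_x(A^c))\,d\rho_1(x).$$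 Functionals of sets $A\in\mathcal{A}$ are regarded as functionals on $\{\mathbf{1}_A:A\in\mathcal{A}\}\subset L^\infty(\mathcal{X};\nu)$ with the weak-* topology (convergence of integrals against every $\varphi\in L^1(\mathcal{X};\nu)$). $F_p$ $\Gamma$-converges to $F$ as $p\to p_0$ if for every sequence $p_n\to p_0$: (i) whenever $\mathbf{1}_{A_n}\to\mathbf{1}_A$ one has $\liminf_n F_{p_n}(A_n)\ge F(A)$; (ii) for every $A$ there is a sequence with $\mathbf{1}_{A_n}\to\mathbf{1}_A$ and $\limsup_n F_{p_n}(A_n)\le F(A)$. *)

(* Defs.v *)
From HB Require Import structures.
From mathcomp Require Import all_boot all_order all_algebra.
From mathcomp Require Import all_classical all_reals all_analysis.
From mathcomp Require Import measurable_realfun.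

Set Implicit Arguments.
Unset Strict Implicit.
Unset Printing Implicit Defensive.
Import Order.TTheory GRing.Theory Num.Theory.
Import numFieldNormedType.Exports.

Local Open Scope classical_set_scope.
Local Open Scope ring_scope.
Local Open Scope ereal_scope.

(* The label set {0,1} is [bool], with [true] as 1; its sigma-algebra is
   discrete. *)
Definition rho_ d (X : measurableType d) (R : realType)
    (mu : probability (X * bool)%type R) (i : bool) (B : set X) : \bar R :=
  mu (B `*` [set i]).

Fact rho_0 d (X : measurableType d) (R : realType)
  (mu : probability (X * bool)%type R) (i : bool) : rho_ mu i set0 = 0.
Proof. by rewrite /rho_ set0X measure0. Qed.

Fact rho_ge0 d (X : measurableType d) (R : realType)
  (mu : probability (X * bool)%type R) (i : bool) (B : set X) :
  0 <= rho_ mu i B.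
Proof. exact: measure_ge0. Qed.

Fact rho_sigma_additive d (X : measurableType d) (R : realType)
  (mu : probability (X * bool)%type R) (i : bool) :
  semi_sigma_additive (rho_ mu i).
Proof.
move=> F mF tF mUF; rewrite /rho_.
have -> : (\bigcup_n F n) `*` [set i] = \bigcup_n (F n `*` [set i]).
  apply/seteqP; split => [[x y] /= [[n _ Fx] yi]|[x y] [n _ /= [Fx yi]]].
    by exists n.
  by split => //; exists n.
apply: measure_semi_sigma_additive.
- by move=> n; exact: measurableX.
- apply/trivIsetP => j k _ _ jk; rewrite -setXI.
  by move/trivIsetP : tF => -> //; rewrite set0X.
- by apply: bigcupT_measurable => n; exact: measurableX.
Qed.

HB.instance Definition _ d (X : measurableType d) (R : realType)
    (mu : probability (X * bool)%type R) (i : bool) :=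
  isMeasure.Build _ _ _ (rho_ mu i)
    (rho_0 mu i) (rho_ge0 mu i) (@rho_sigma_additive _ _ _ mu i).

Definition rho d (X : measurableType d) (R : realType)
    (mu : probability (X * bool)%type R) : {measure set X -> \bar R} :=
  measure_add (rho_ mu false) (rho_ mu true).

(* Outside a [lam]-negligible set of points, [m x] is an arbitrary set
   function. *)
Record prob_family d (X : measurableType d) (R : realType)
    (lam : {measure set X -> \bar R}) := ProbFamily {
  family_fun :> X -> set X -> \bar R ;
  family_ae_prob : {ae lam, forall x, exists P : probability X R,
    forall B, measurable B -> family_fun x B = P B} ;
  family_measurable : forall B, measurable B ->
    measurable_fun [set: X] (family_fun ^~ B) }.

(* A [measure] of the library must be nonnegative on all subsets of [X], hence
   the value 0 on the non-measurable ones. *)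
Definition nu d (X : measurableType d) (R : realType)
    (mu : probability (X * bool)%type R) (m : prob_family (rho mu))
    (B : set X) : \bar R :=
  if `[< measurable B >] then
    (2^-1)%:E * \int[rho mu]_x m x B + (2^-1)%:E * rho mu B
  else 0.

Fact nu_abs d (X : measurableType d) (R : realType)
    (mu : probability (X * bool)%type R) (m : prob_family (rho mu))
    (B : set X) : measurable B ->
  nu m B = (2^-1)%:E * \int[rho mu]_x `|m x B| + (2^-1)%:E * rho mu B.
Proof.
move=> mB; rewrite /nu asboolT//; congr (_ * _ + _).
apply: ae_eq_integral => //.
- exact: family_measurable.
- by apply: measurableT_comp => //; exact: family_measurable.
apply: filterS (family_ae_prob m) => x [P mP] _.
by rewrite mP// gee0_abs.
Qed.

Fact nu0 d (X : measurableType d) (R : realType)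
  (mu : probability (X * bool)%type R) (m : prob_family (rho mu)) :
  nu m set0 = 0.
Proof.
rewrite nu_abs// measure0 mule0 adde0.
rewrite (ae_eq_integral (cst 0))//; first by rewrite integral0 mule0.
- by apply: measurableT_comp => //; exact: family_measurable.
apply: filterS (family_ae_prob m) => x [P mP] _.
by rewrite mP// measure0 abse0.
Qed.

Fact nu_ge0 d (X : measurableType d) (R : realType)
  (mu : probability (X * bool)%type R) (m : prob_family (rho mu))
  (B : set X) : 0 <= nu m B.
Proof.
have [mB|nmB] := pselect (measurable B); last by rewrite /nu asboolF.
by rewrite nu_abs// adde_ge0// mule_ge0// integral_ge0.
Qed.

Fact nu_sigma_additive d (X : measurableType d) (R : realType)
  (mu : probability (X * bool)%type R) (m : prob_family (rho mu)) :
  semi_sigma_additive (nu m).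
Proof.
move=> F mF tF mUF.
have mabs B : measurable B -> measurable_fun [set: X] (fun x => `|m x B| : \bar R).
  by move=> mB; apply: measurableT_comp => //; exact: family_measurable.
have intU : \int[rho mu]_x `|m x (\bigcup_n F n)| =
    \sum_(0 <= i <oo) \int[rho mu]_x `|m x (F i)|.
  rewrite -integral_nneseries//; last by move=> n; exact: mabs.
  apply: ae_eq_integral => //; first exact: mabs.
    by apply: ge0_emeasurable_sum => // n _; exact: mabs.
  apply: filterS (family_ae_prob m) => x [P mP] _.
  rewrite mP// gee0_abs// measure_semi_bigcup//.
  by apply: eq_eseriesr => n _; rewrite mP// gee0_abs.
rewrite nu_abs//.
under eq_fun do under eq_bigr do rewrite nu_abs//.
rewrite (_ : (fun n => _) = (fun n =>
    (2^-1)%:E * (\sum_(0 <= i < n) \int[rho mu]_x `|m x (F i)|)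
    + (2^-1)%:E * (\sum_(0 <= i < n) rho mu (F i)))); last first.
  apply/funext => n; rewrite big_split/= ge0_sume_distrr ?ge0_sume_distrr//.
  by move=> i _; exact: integral_ge0.
apply: cvgeD.
- by rewrite ge0_adde_def// inE mule_ge0// integral_ge0.
- apply: cvgeZl => //; rewrite intU.
  by apply: is_cvg_nneseries => n _ _; exact: integral_ge0.
- by apply: cvgeZl => //; exact: measure_semi_sigma_additive.
Qed.

HB.instance Definition _ d (X : measurableType d) (R : realType)
    (mu : probability (X * bool)%type R) (m : prob_family (rho mu)) :=
  isMeasure.Build _ _ _ (nu m) (nu0 m) (nu_ge0 m) (@nu_sigma_additive _ _ _ _ m).

(* [fine] is harmless: [m x] takes values in [0, 1] for almost every [x]. *)
Definition ProbR d (X : measurableType d) (R : realType)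
    (mu : probability (X * bool)%type R) (m : prob_family (rho mu))
    (Psi : R -> R) (A : set X) : \bar R :=
  rho_ mu false A + rho_ mu true (~` A)
  + \int[rho_ mu false]_(x in ~` A) (Psi (fine (m x A)))%:E
  + \int[rho_ mu true]_(x in A) (Psi (fine (m x (~` A))))%:E.

Definition Psi_ (R : realType) (p t : R) : R := Num.min (t / p)%R 1%R.

Definition risk d (X : measurableType d) (R : realType)
    (mu : probability (X * bool)%type R) (A : set X) : \bar R :=
  'E_mu[fun z => `|\1_A z.1 - (z.2 : nat)%:R|%R].

Definition weakstar_cvg_indic d (X : measurableType d) (R : realType)
    (lam : {measure set X -> \bar R}) (A_ : nat -> set X) (A : set X) : Prop :=
  forall phi : X -> R, lam.-integrable [set: X] (EFin \o phi) ->
    \int[lam]_x (\1_(A_ n) x * phi x)%:E @[n --> \oo] -->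
    \int[lam]_x (\1_A x * phi x)%:E.

(* Gamma-convergence as the parameter [p], constrained to [D], tends to its
   limit along the filter [G]. *)
Definition Gamma_cvg d (X : measurableType d) (R : realType)
    (lam : {measure set X -> \bar R}) (F : R -> set X -> \bar R) (D : set R)
    (G : set_system R) (F0 : set X -> \bar R) : Prop :=
  forall p_ : nat -> R, (forall n, D (p_ n)) -> p_ n @[n --> \oo] --> G ->
    (forall (A_ : nat -> set X) (A : set X),
       (forall n, measurable (A_ n)) -> measurable A ->
       weakstar_cvg_indic lam A_ A ->
       F0 A <= limn_einf (fun n => F (p_ n) (A_ n)))
    /\
    (forall A : set X, measurable A ->
       exists A_ : nat -> set X,
         [/\ forall n, measurable (A_ n),
             weakstar_cvg_indic lam A_ A &
             limn_esup (fun n => F (p_ n) (A_ n)) <= F0 A]).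

(* Main.v *)
(* With q := 1/p the functional is an integral against rho_0 and rho_1 of losses
   in [0, 1], and it changes by at most |q - c| + 2(1 + c) nu(A + B), where + is
   the symmetric difference, when (q, B) replaces (c, A).  Weak-* convergence of
   indicators to an indicator is convergence of nu(A + A_n) to 0: test against
   the indicators of A and of its complement.  Hence the functionals converge
   along every such sequence, and constant sequences are recovery sequences;
   p -> 1 and p -> oo are the limits q -> 1 and q -> 0. *)
From HB Require Import structures.
Require Import Defs.
From mathcomp Require Import all_boot all_order all_algebra.
From mathcomp Require Import all_classical all_reals all_analysis.
From mathcomp Require Import measurable_realfun.
From mathcomp Require Import ring lra.

Set Implicit Arguments.
Unset Strict Implicit.
Unset Printing Implicit Defensive.
Import Order.TTheory GRing.Theory Num.Theory.
Import numFieldNormedType.Exports.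

Local Open Scope classical_set_scope.
Local Open Scope ring_scope.
Local Open Scope ereal_scope.

(** * Integrals against bare set functions and of possibly non-measurable integrands *)

Section integral_complements.
Context d (X : measurableType d) (R : realType).
Import HBNNSimple.

(** Simple functions have measurable level sets, so the integral never evaluates the set function
    elsewhere. This replaces [m x] by a genuine probability [P] in the inner integrals. *)
Lemma eq_measurable_integral (nu1 nu2 : set X -> \bar R) (D : set X)
    (f : X -> \bar R) :
  (forall B, measurable B -> nu1 B = nu2 B) ->
  \int[nu1]_(x in D) f x = \int[nu2]_(x in D) f x.
Proof.
move=> nu12; have sE (h : {nnsfun X >-> R}) : sintegral nu1 h = sintegral nu2 h.
  by apply: eq_fsbigr => r _; rewrite nu12.
by rewrite /integral; congr (ereal_sup _ - ereal_sup _); apply: eq_imagel.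
Qed.

Variable lam : {measure set X -> \bar R}.

(* Needed without measurability of [f] and [g]: on the exceptional null set
   [m x] is arbitrary, so [x |-> \int[m x]_(xt in A) 1] may fail to be measurable. *)
Lemma ge0_ae_le_integral_nonmeas (f g : X -> \bar R) :
  (forall x, 0 <= f x) -> (forall x, 0 <= g x) ->
  {ae lam, forall x, f x <= g x} ->
  \int[lam]_x f x <= \int[lam]_x g x.
Proof.
move=> f0 g0 [N [mN N0 fgN]].
rewrite !ge0_integralTE//; apply: ge_ereal_sup => _ [h /= hf <-].
(* Cutting [h] off on the null set [N] preserves its integral and puts it below [g] everywhere, so
   it competes in the supremum defining the integral of [g]. *)
pose h' := mul_nnsfun h (indic_nnsfun R (measurableC mN)).
apply: (@le_trans _ _ (sintegral lam h')); last first.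
  apply: ereal_sup_ubound; exists h' => //= x.
  rewrite /mindic indicE; have [xN|xN] := pselect (N x).
    by rewrite memNset ?mulr0//=; apply.
  rewrite mem_set// mulr1; apply: (le_trans (hf x)).
  by apply: contrapT => nfg; exact/xN/fgN.
rewrite le_eqVlt; apply/orP; left; apply/eqP.
have sE (k : {nnsfun X >-> R}) : sintegral lam k = \int[lam]_x (k x)%:E.
  by rewrite integral_nnsfun//; congr sintegral; rewrite patch_setT.
rewrite !sE; apply: ae_eq_integral => //.
- by apply/measurable_EFinP.
- by apply/measurable_EFinP.
exists N; split => // x /= hh'; apply: contrapT => xN; apply: hh' => _.
by rewrite /= /mindic indicE mem_set// mulr1.
Qed.

Lemma ae_eq_integral_nonmeas (D : set X) (f g : X -> \bar R) :
  {ae lam, forall x, D x -> f x = g x} ->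
  \int[lam]_(x in D) f x = \int[lam]_(x in D) g x.
Proof.
move=> fg; rewrite integral_mkcond [RHS]integral_mkcond.
have {}fg : {ae lam, forall x, (f \_ D) x = (g \_ D) x}.
  by apply: filterS fg => x fgx; rewrite /patch; case: ifPn => // /set_mem.
rewrite integralE [RHS]integralE; congr (_ - _); apply/eqP; rewrite eq_le.
- by apply/andP; split; apply: ge0_ae_le_integral_nonmeas => //;
    apply: filterS fg => x fgx; rewrite !funeposE fgx.
- by apply/andP; split; apply: ge0_ae_le_integral_nonmeas => //;
    apply: filterS fg => x fgx; rewrite !funenegE fgx.
Qed.

End integral_complements.

(** * The pointwise loss and its dependence on the parameter and the set *)

Section loss.
Context d (X : measurableType d) (R : realType).
Implicit Types (mu : probability (X * bool)%type R) (A B : set X) (q c : R).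

(* The maximum keeps the values in [0, 1] also where [m x] is not a probability.
   The parameter [q] stands for [1 / p], so that [q = 0] is [p = +oo]. *)
Definition loss (m : X -> set X -> \bar R) q A (x : X) : R :=
  (Num.max (\1_A x) (Num.min (fine (m x A) * q) 1))%R.

Lemma loss_ge0 m q A x : (0 <= loss m q A x)%R.
Proof. by rewrite /loss le_max indicE ler0n. Qed.

Lemma loss_le1 m q A x : (loss m q A x <= 1)%R.
Proof. by rewrite /loss ge_max indicE lern1 leq_b1 ge_min lexx orbT. Qed.

Lemma loss_in m q A x : A x -> loss m q A x = 1%R.
Proof.
by move=> Ax; rewrite /loss indicE mem_set// max_l// ge_min lexx orbT.
Qed.

Lemma loss_notin m q A x : ~ A x -> (0 <= fine (m x A) * q)%R ->
  loss m q A x = (Num.min (fine (m x A) * q) 1)%R.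
Proof.
by move=> nAx mq0; rewrite /loss indicE memNset// max_r// le_min mq0/=.
Qed.

(** On the symmetric difference the indicator alone pays, since losses lie in [0, 1]; on [A] and [B]
    jointly both losses are 1; off both sets, capping at 1 is monotone and 1-Lipschitz, and [P B]
    exceeds [P A] by at most the mass of the symmetric difference. *)
Lemma loss_lipschitz (P : probability X R) (m : X -> set X -> \bar R) q c A B x :
  (forall C, measurable C -> m x C = P C) -> measurable A -> measurable B ->
  (0 <= q)%R -> (0 <= c)%R ->
  (loss m q B x <= loss m c A x + (\1_(A `+` B) x + (`|q - c|
    + c * fine `|m x (A `+` B)%classic|)))%R.
Proof.
move=> mP mA mB q0 c0.
have mD : measurable (A `+` B) by apply: measurableU; exact: measurableD.
set D := A `+` B in mD *.
have fineP C : measurable C -> ((fine (P C))%:E = P C).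
  by move=> mC; rewrite fineK// fin_num_measure.
have PB1 : (fine (P B) <= 1)%R by rewrite -lee_fin fineP// probability_le1.
have PB0 : (0 <= fine (P B))%R by rewrite fine_ge0.
have PA0 : (0 <= fine (P A))%R by rewrite fine_ge0.
have PBA : (fine (P B) <= fine (P A) + fine (P D))%R.
  rewrite -lee_fin EFinD !fineP//; apply: le_trans (measureU2 _ _ _) => //.
  apply: le_measure; rewrite ?inE//; first exact: measurableU.
  move=> y By; have [Ay|nAy] := pselect (A y); first by left.
  by right; right.
have D0 : (0 <= fine (P D))%R by rewrite fine_ge0.
rewrite gee0_abs ?mP//.
have [Dx|nDx] := pselect (D x).
  rewrite [\1_D x]indicE mem_set//=.
  have := loss_ge0 m c A x; have := loss_le1 m q B x.
  have : (0 <= c * fine (P D))%R by rewrite mulr_ge0.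
  have := normr_ge0 (q - c)%R; lra.
have [Ax|nAx] := pselect (A x).
  rewrite (loss_in _ _ Ax) [\1_D x]indicE memNset//=.
  have := loss_le1 m q B x.
  have : (0 <= c * fine (P D))%R by rewrite mulr_ge0.
  have := normr_ge0 (q - c)%R; lra.
have nBx : ~ B x by move=> Bx; apply: nDx; right.
rewrite !loss_notin ?mP ?mulr_ge0// [\1_D x]indicE memNset//=.
have cD0 : (0 <= c * fine (P D))%R by rewrite mulr_ge0.
have q1 : (fine (P B) * q <= fine (P A) * c + `|q - c| + c * fine (P D))%R.
  (* The change of parameter is isolated with weight [P B], at most 1; hence the coefficient 1 of
     [|q - c|]. *)
  have -> : (fine (P B) * q = fine (P B) * c + fine (P B) * (q - c))%R by ring.
  have : (fine (P B) * c <= (fine (P A) + fine (P D)) * c)%R by rewrite ler_wpM2r.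
  have : (fine (P B) * (q - c) <= `|q - c|)%R.
    apply: (le_trans (ler_norm _)); rewrite normrM ger0_norm//.
    by rewrite ler_piMl.
  lra.
rewrite add0r; have [Ac1|Ac1] := leP (fine (P A) * c)%R 1%R.
  by rewrite ge_min addrA q1.
rewrite ge_min; apply/orP; right.
have := normr_ge0 (q - c)%R; lra.
Qed.

Lemma measurable_loss (m : X -> set X -> \bar R) q A : measurable A ->
  measurable_fun [set: X] (m ^~ A) ->
  measurable_fun [set: X] (fun x => (loss m q A x)%:E).
Proof.
move=> mA mm; apply/measurable_EFinP; apply: measurable_maxr => //.
apply: measurable_minr => //; apply: measurable_funM => //.
by apply: measurableT_comp mm.
Qed.

End loss.

(** * The functional as an integrated loss, and its continuity *)

Section total_loss.
Context d (X : measurableType d) (R : realType).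
Variables (mu : probability (X * bool)%type R) (m : prob_family (rho mu)).
Implicit Types (A B : set X) (q c : R).

Lemma rhoE B : rho mu B = rho_ mu false B + rho_ mu true B.
Proof. exact: measure_addE. Qed.

Lemma rho_setT : rho mu setT = 1.
Proof.
have disj : [set: X] `*` [set false] `&` [set: X] `*` [set true] = set0.
  by apply/seteqP; split => // -[x b] [[_ /= ->] []].
rewrite rhoE /rho_ -measureU//; [|exact: measurableX..].
rewrite (_ : _ `|` _ = setT); first exact: probability_setT.
by apply/seteqP; split => // -[x []] _; [right|left].
Qed.

Lemma rho_le_rho i B : rho_ mu i B <= rho mu B.
Proof.
by rewrite rhoE; case: i; [rewrite leeDr|rewrite leeDl].
Qed.

Lemma ae_rho_ i (Q : X -> Prop) :
  {ae rho mu, forall x, Q x} -> {ae rho_ mu i, forall x, Q x}.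
Proof.
move=> [N [mN N0 QN]]; exists N; split => //; apply/eqP.
by rewrite eq_le measure_ge0 -N0 rho_le_rho.
Qed.

(** The loss is 1 on [A], which yields the mass term. Off [A] it is the capped term wherever [m x A]
    is nonnegative, hence almost everywhere. *)
Lemma rho_loss i q A : measurable A -> (0 <= q)%R ->
  rho_ mu i A
    + \int[rho_ mu i]_(x in ~` A) (Num.min (fine (m x A) * q) 1)%R%:E =
  \int[rho_ mu i]_x (loss m q A x)%:E.
Proof.
move=> mA q0; have mC := measurableC mA.
have mm := family_measurable m mA.
have mL : measurable_fun setT (fun x => (loss m q A x)%:E).
  exact: measurable_loss.
have mLD D : measurable D -> measurable_fun D (fun x => (loss m q A x)%:E).
  by move=> mD; apply: measurable_funTS.
rewrite -(setUv A) ge0_integral_setU//; last 3 first.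
- by rewrite setUv.
- by move=> x _; rewrite lee_fin loss_ge0.
- exact/disj_setPCl.
congr (_ + _).
  rewrite (eq_integral (cst 1)) ?integral_cst ?mul1e//.
  by move=> x /set_mem Ax; rewrite loss_in.
apply: ae_eq_integral => //; last first.
- apply: filterS (ae_rho_ i (family_ae_prob m)) => x [P mP] nAx.
  rewrite loss_notin// mulr_ge0// mP// fine_ge0//.
- exact: mLD.
apply/measurable_EFinP/measurable_funTS.
apply: measurable_minr => //; apply: measurable_funM => //.
exact: measurableT_comp mm.
Qed.

(** A point labelled [true] is misclassified off [A], hence the complement in the second term. *)
Definition total_loss q A : \bar R :=
  \int[rho_ mu false]_x (loss m q A x)%:E
  + \int[rho_ mu true]_x (loss m q (~` A) x)%:E.

Lemma ProbR_total_loss q A : measurable A -> (0 <= q)%R ->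
  ProbR m (fun t => Num.min (t * q) 1)%R A = total_loss q A.
Proof.
move=> mA q0; have mC := measurableC mA.
rewrite /total_loss -!rho_loss// setCK /ProbR.
by rewrite [RHS]addeACA; exact/esym/addeA.
Qed.

Lemma rho_le_nu D : measurable D ->
  rho mu D + \int[rho mu]_x `|m x D| = 2%:E * nu m D.
Proof.
move=> mD; rewrite nu_abs// muleDr//; last first.
  by rewrite ge0_adde_def// inE mule_ge0// integral_ge0.
by rewrite !muleA -!EFinM divff// !mul1e addeC.
Qed.

(** The pointwise bound is integrated for the sets under label [false] and for their complements
    under label [true]. Both pairs have the same symmetric difference, so the two error terms add up
    to one integral against [rho mu], of total mass 1. *)
Lemma total_loss_lipschitz q c A B : measurable A -> measurable B ->
  (0 <= q)%R -> (0 <= c)%R ->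
  total_loss q B <= total_loss c A
    + (`|q - c|%:E + (1 + c)%:E * (2%:E * nu m (A `+` B))).
Proof.
move=> mA mB q0 c0.
have mD : measurable (A `+` B) by apply: measurableU; exact: measurableD.
have mAC := measurableC mA; have mBC := measurableC mB.
pose g x := (\1_(A `+` B) x)%:E
  + (`|q - c|%:E + c%:E * `|m x (A `+` B)%classic|).
have g0 x : 0 <= g x.
  by rewrite /g !adde_ge0 ?lee_fin ?indicE ?mule_ge0.
have mabs : measurable_fun [set: X] (fun x => `|m x (A `+` B)%classic| : \bar R).
  by apply: measurableT_comp => //; exact: family_measurable.
have mcabs : measurable_fun [set: X]
    (fun x => c%:E * `|m x (A `+` B)%classic| : \bar R).
  by apply: emeasurable_funM.
have mg1 : measurable_fun [set: X]
    (fun x => `|q - c|%:E + c%:E * `|m x (A `+` B)%classic| : \bar R).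
  by apply: emeasurable_funD.
have mg2 : measurable_fun [set: X] (fun x => (\1_(A `+` B) x)%:E : \bar R).
  exact/measurable_EFinP.
have mg : measurable_fun [set: X] g by apply: emeasurable_funD.
have half i A' B' : measurable A' -> measurable B' -> A' `+` B' = A `+` B ->
    \int[rho_ mu i]_x (loss m q B' x)%:E <=
    \int[rho_ mu i]_x (loss m c A' x)%:E + \int[rho_ mu i]_x g x.
  move=> mA' mB' D'; rewrite -ge0_integralD//; last 2 first.
  - by move=> x _; rewrite lee_fin loss_ge0.
  - by apply: measurable_loss => //; exact: family_measurable.
  apply: ae_ge0_le_integral => //.
  - by move=> x _; rewrite lee_fin loss_ge0.
  - by apply: measurable_loss => //; exact: family_measurable.
  - by move=> x _; rewrite adde_ge0// lee_fin loss_ge0.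
  - apply: emeasurable_funD => //.
    by apply: measurable_loss => //; exact: family_measurable.
  apply: filterS (ae_rho_ i (family_ae_prob m)) => x [P mP] _.
  have := loss_lipschitz mP mA' mB' q0 c0.
  rewrite -lee_fin !EFinD EFinM D' fineK//.
  by rewrite mP// abse_fin_num fin_num_measure.
have DC : ~` A `+` ~` B = A `+` B.
  by rewrite /setY !setDE !setCK setUC [B `&` _]setIC [~` B `&` _]setIC.
apply: (le_trans (leeD (half false _ _ mA mB erefl)
                       (half true _ _ mAC mBC DC))).
rewrite addeACA; apply: leeD => //.
rewrite -ge0_integral_measure_add//.
rewrite -/(rho mu) ge0_integralD//; last first.
  by move=> x _; rewrite adde_ge0// mule_ge0.
rewrite ge0_integralD//; last by move=> x _; rewrite mule_ge0.
rewrite integral_indic// setIT integral_cst// rho_setT mule1 ge0_integralZl//.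
rewrite addeCA leeD2l// -rho_le_nu//.
(* With [r] the [rho mu] mass of the symmetric difference and [I] this integral, what remains is
   [r + c I <= (1 + c) (r + I)], where [r + I] is twice the [nu m] mass. *)
have : 0 <= \int[rho mu]_x `|m x (A `+` B)%classic| by exact: integral_ge0.
move: (\int[rho mu]_x _) => I I0.
rewrite EFinD ge0_muleDl ?lee_fin// mul1e ge0_muleDr// addeACA.
by rewrite leeD// ?leeDl ?leeDr ?mule_ge0.
Qed.


(** Gives finiteness of [nu m], which makes indicators of measurable sets integrable test
    functions. *)
Lemma nu_le1 B : measurable B -> nu m B <= 1.
Proof.
move=> mB; have Dr : \int[rho mu]_x `|m x B| <= 1.
  rewrite -rho_setT -[leRHS]mul1e -integral_cst//.
  apply: ae_ge0_le_integral => //.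
    by apply: measurableT_comp => //; exact: family_measurable.
  apply: filterS (family_ae_prob m) => x [P mP] _.
  by rewrite mP// gee0_abs// probability_le1.
have rB : rho mu B <= 1.
  by rewrite -rho_setT; apply: le_measure; rewrite ?inE.
rewrite nu_abs//; apply: (@le_trans _ _ ((2^-1)%:E * 1 + (2^-1)%:E * 1)).
  by apply: leeD; rewrite lee_wpmul2l.
by rewrite !mule1 -EFinD lee_fin; lra.
Qed.

Lemma nu_fin_num : fin_num_fun (nu m).
Proof.
move=> B mB; rewrite ge0_fin_numE//.
by rewrite (le_lt_trans (nu_le1 mB))// ltry.
Qed.

HB.instance Definition _ := Measure_isFinite.Build _ _ _ (nu m) nu_fin_num.

Lemma total_loss_cvg (q_ : nat -> R) c (A_ : nat -> set X) A :
  (forall n, measurable (A_ n)) -> measurable A ->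
  (forall n, (0 <= q_ n)%R) -> q_ n @[n --> \oo] --> c ->
  nu m (A `+` A_ n) @[n --> \oo] --> 0 ->
  total_loss (q_ n) (A_ n) @[n --> \oo] --> total_loss c A.
Proof.
move=> mA_ mA q0 qc nuD0.
have c0 : (0 <= c)%R.
  by apply: (ler_cvg_to (cvg_cst 0%R) qc); exact: nearW.
have mD n : measurable (A `+` A_ n).
  by apply: measurableU; exact: measurableD.
have {}nuD0 : fine (nu m (A `+` A_ n)) @[n --> \oo] --> (0 : R)%R.
  exact: fine_cvg.
(* The Lipschitz bound is used in both directions, with constants [1 + c] and [1 + q_ n]; the factor
   [1 + c + q_ n] dominates both and stays bounded. *)
pose e n : R := (`|q_ n - c| + (1 + c + q_ n) * (2 * fine (nu m (A `+` A_ n))))%R.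
have e0 : e n @[n --> \oo] --> (0 : R)%R.
  rewrite [X in _ --> X](_ : _ = `|c - c| + (1 + c + c) * (2 * 0))%R; last first.
    by rewrite subrr normr0 !mulr0 addr0.
  apply: cvgD.
    by apply: cvg_norm; apply: cvgB => //; exact: cvg_cst.
  apply: cvgM; first by apply: cvgD => //; exact: cvg_cst.
  by apply: cvgM => //; exact: cvg_cst.
have eE n a : (0 <= a)%R -> (a <= c + q_ n)%R ->
    `|q_ n - c|%:E + (1 + a)%:E * (2%:E * nu m (A `+` A_ n)) <= (e n)%:E.
  move=> a0 ac; rewrite -(fineK (nu_fin_num (mD n))) -!EFinM -EFinD lee_fin.
  rewrite lerD2l ler_wpM2r ?mulr_ge0 ?fine_ge0//.
  by rewrite -addrA lerD2l.
apply: (@squeeze_cvge _ _ _ _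
  (fun n => total_loss c A - (e n)%:E) _ (fun n => total_loss c A + (e n)%:E)).
- apply: nearW => n; apply/andP; split.
    rewrite leeBlDr//.
    apply: (le_trans (total_loss_lipschitz (mA_ n) mA c0 (q0 n))).
    rewrite leeD2l// distrC setYC eE// lerDr//.
  apply: (le_trans (total_loss_lipschitz mA (mA_ n) (q0 n) c0)).
  by rewrite leeD2l// eE// lerDl.
- rewrite -[X in _ --> X]sube0; apply: cvgeB; first exact: fin_num_adde_defl.
    exact: cvg_cst.
  by apply: cvg_EFin => //; exact: nearW.
- rewrite -[X in _ --> X]adde0; apply: cvgeD; first exact: fin_num_adde_defl.
    exact: cvg_cst.
  by apply: cvg_EFin => //; exact: nearW.
Qed.

End total_loss.

(** * From weak-* convergence of indicators to convergence in measure *)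

Lemma weakstar_cvg_indic_setY d (X : measurableType d) (R : realType)
    (lam : {finite_measure set X -> \bar R}) (A_ : nat -> set X) (A : set X) :
  (forall n, measurable (A_ n)) -> measurable A ->
  weakstar_cvg_indic lam A_ A -> lam (A `+` A_ n) @[n --> \oo] --> 0.
Proof.
move=> mA_ mA wA.
have intI B C : measurable B -> measurable C ->
    \int[lam]_x (\1_B x * \1_C x)%:E = lam (B `&` C).
  move=> mB mC; rewrite -[X in lam X](setIT (B `&` C)) -integral_indic//; last exact: measurableI.
  by apply: eq_integral => x _; rewrite indicI.
have wI C : measurable C -> lam (A_ n `&` C) @[n --> \oo] --> lam (A `&` C).
  move=> mC; have := wA _ (integrable_indic lam mC).
  by rewrite intI//; under eq_fun do rewrite intI//.
(* Test against the complement of [A]: the limit set does not meet it. *)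
have AD : lam (A_ n `\` A) @[n --> \oo] --> 0.
  have := wI _ (measurableC mA); rewrite setICr measure0.
  by under eq_fun do rewrite -setDE.
(* Test against [A] itself: the mass of [A] captured by [A_ n] tends to the whole, which is finite
   and may be subtracted. *)
have DA : lam (A `\` A_ n) @[n --> \oo] --> 0.
  have -> : (fun n => lam (A `\` A_ n)) = (fun n => lam A - lam (A_ n `&` A)).
    apply/funext => n; rewrite measureD// 1?setIC//.
    by rewrite -ge0_fin_numE// fin_num_measure.
  rewrite -[X in _ --> X](@subee _ (lam A)) ?fin_num_measure//.
  apply: cvgeB; last by rewrite -[X in _ --> lam X]setIid; exact: wI.
    by rewrite fin_num_adde_defl// fin_numN fin_num_measure.
  exact: cvg_cst.
have -> : (fun n => lam (A `+` A_ n)) =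
    (fun n => lam (A `\` A_ n) + lam (A_ n `\` A)).
  apply/funext => n; rewrite setY_def measureU//; [exact: measurableD..|].
  by apply/seteqP; split => // x [[Ax _] []].
by rewrite -[X in _ --> X]adde0; exact: cvgeD.
Qed.

(** * Identification of the two limit functionals and Gamma-convergence *)

Section limits.
Context d (X : measurableType d) (R : realType).
Variables (mu : probability (X * bool)%type R) (m : prob_family (rho mu)).

Lemma risk_rho A : measurable A ->
  risk mu A = rho_ mu false A + rho_ mu true (~` A).
Proof.
move=> mA; rewrite /risk unlock.
have m0 : measurable (A `*` [set false]) by exact: measurableX.
have m1 : measurable (~` A `*` [set true]).
  by apply: measurableX => //; exact: measurableC.
(* The absolute error takes only the values 0 and 1, so it is the indicator of the misclassified
   pairs. *)
rewrite (eq_integral (fun z => (\1_(A `*` [set false] `|` ~` A `*` [set true]) z)%:E)).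
  rewrite integral_indic ?setIT//; last exact: measurableU.
  rewrite measureU//.
  by apply/seteqP; split => // -[x b] [[/= Ax _] []].
move=> [x b] _; congr EFin; rewrite !indicE/=.
have [Ax|nAx] := pselect (A x).
  rewrite (mem_set Ax); case: b.
    by rewrite subrr normr0 memNset//= => -[] [].
  by rewrite subr0 normr1 mem_set//; left.
rewrite (memNset nAx); case: b.
  by rewrite sub0r normrN normr1 mem_set//; right.
by rewrite subrr normr0 memNset//= => -[] [].
Qed.

Lemma risk_total_loss A : measurable A -> risk mu A = total_loss m 0 A.
Proof.
move=> mA; rewrite -ProbR_total_loss// /ProbR risk_rho//.
by rewrite !integral0_eq ?adde0// => x _; rewrite mulr0 min_l.
Qed.

(** For almost every [x] the inner integral is a probability, so at [q = 1] the cap at 1 is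
    inactive. *)
Lemma adversarial_risk_total_loss A : measurable A ->
  risk mu A
  + \int[rho_ mu true]_(x in A) \int[m x]_(xt in ~` A) 1
  + \int[rho_ mu false]_(x in ~` A) \int[m x]_(xt in A) 1 = total_loss m 1 A.
Proof.
move=> mA; rewrite -ProbR_total_loss// /ProbR risk_rho// addeAC.
have inner i (C D : set X) : measurable C ->
    \int[rho_ mu i]_(x in D) \int[m x]_(xt in C) 1 =
    \int[rho_ mu i]_(x in D) (Num.min (fine (m x C) * 1) 1)%R%:E.
  move=> mC; apply: ae_eq_integral_nonmeas.
  apply: filterS (ae_rho_ i (family_ae_prob m)) => x [P mP] _.
  rewrite (eq_measurable_integral _ _ mP) integral_cst// mul1e mP// mulr1.
  rewrite min_l ?fineK ?fin_num_measure//.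
  by rewrite -lee_fin fineK ?fin_num_measure// probability_le1.
by rewrite !inner//; exact: measurableC.
Qed.

(** Common to both regimes: only the limit [c] of the inverse parameters matters, and the values
    converge, so both inequalities come from equalities. *)
Lemma Gamma_cvg_total_loss (G : set_system R) (F0 : set X -> \bar R) c :
  (forall A, measurable A -> F0 A = total_loss m c A) ->
  (forall p_ : nat -> R, (forall n, (0 < p_ n)%R) -> p_ n @[n --> \oo] --> G ->
    ((p_ n)^-1)%R @[n --> \oo] --> c) ->
  Gamma_cvg (nu m) (fun p => ProbR m (Psi_ p)) [set p : R | (0 < p)%R] G F0.
Proof.
move=> F0E Gc p_ p0 /Gc-/(_ p0) pc.
have q0 n : (0 <= (p_ n)^-1)%R by rewrite invr_ge0 ltW//; exact: p0.
have FE B_ : (forall n, measurable (B_ n)) ->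
    (fun n => ProbR m (Psi_ (p_ n)) (B_ n))
    = (fun n => total_loss m (p_ n)^-1%R (B_ n)).
  (* [t / p] is by definition [t] times the inverse of [p], so [Psi_ p] already has the capped form
     with [q] equal to that inverse. *)
  by move=> mB; apply/funext => n; exact: ProbR_total_loss.
split=> [A_ A mA_ mA wA|A mA].
  rewrite FE// F0E//.
  have AA_ := weakstar_cvg_indic_setY mA_ mA wA.
  by have [->] := cvg_limn_einf_sup (total_loss_cvg mA_ mA q0 pc AA_).
exists (fun=> A); split => //.
  by move=> phi _; exact: cvg_cst.
rewrite FE// F0E//.
have AA : nu m (A `+` A) @[_ --> \oo] --> 0.
  by rewrite setYK measure0; exact: cvg_cst.
by have [_ ->] := cvg_limn_einf_sup (total_loss_cvg (fun=> mA) mA q0 pc AA).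
Qed.

End limits.

Theorem theorem8 (R : realType) (d : measure_display) (X : measurableType d)
    (mu : probability (X * bool)%type R) (m : prob_family (rho mu)) :
  Gamma_cvg (nu m) (fun p => ProbR m (Psi_ p))
    [set p : R | (0 < p)%R] (nbhs (1%R : R))
    (fun A => risk mu A
       + \int[rho_ mu true]_(x in A) \int[m x]_(xt in ~` A) 1
       + \int[rho_ mu false]_(x in ~` A) \int[m x]_(xt in A) 1)
  /\
  Gamma_cvg (nu m) (fun p => ProbR m (Psi_ p))
    [set p : R | (0 < p)%R] (pinfty_nbhs R)
    (fun A => risk mu A).
Proof.
split.
  apply: (Gamma_cvg_total_loss (@adversarial_risk_total_loss _ _ _ mu m)).
  by move=> p_ p0 p1; rewrite -[X in _ --> X]invr1; apply: cvgV.
apply: (Gamma_cvg_total_loss (@risk_total_loss _ _ _ mu m)) => p_ p0 poo.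
by apply/gtr0_cvgV0 => //; exact: nearW.
Qed.
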